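(* For every integer $k \ge 3$, the simple continued fraction of $\sqrt{R_{N_k}}$ begins $$\sqrt{R_{N_k}} = \Bigl[0;\; M_k-1,\; 1,\; 6M_k^3+12M_k-2,\; 1,\; \Bigl\lfloor\tfrac{10M_k-261}{261}\Bigr\rfloor,\; \Bigl\lfloor\tfrac{261}{r_k}\Bigr\rfloor + \epsilon_k,\; \ldots\Bigr],$$ where $r_k = (10M_k) \bmod 261 \in \{0,1,\ldots,260\}$, and $\epsilon_k = -1$ if $r_k \mid 261$, $\epsilon_k = 0$ otherwise. That is, after the integer part $0$, the first six partial quotients are, in order, the six integers displayed.
   Context: For an integer $N\ge 1$ let $S_N = \sum_{j=1}^N j^{-3}$ and $R_N = \zeta(3) - S_N = \sum_{j>N} j^{-3} > 0$. The Pell numbers are defined by $P_0=0$, $P_1=1$, $P_n = 2P_{n-1}+P_{n-2}$ for $n \ge 2$. The companion Pell numbers are $Q_0 = 1$ and $Q_n = P_n + P_{n-1}$ for $n\ge 1$ (so $1,1,3,7,17,41,99,239,\ldots$). For $k\ge 1$ set $M_k = P_{2k+1}$ and $N_k = (Q_{2k+1}-1)/2$, which is an integer ($N_1,N_2,N_3,\ldots = 3, 20, 119, \ldots$). The simple continued fraction $[a_0; a_1, a_2, \ldots]$ of a real number $x$ is the one produced by the usual algorithm: $x_0 = x$, $a_i = \lfloor x_i \rfloor$, $x_{i+1} = 1/(x_i - a_i)$ as long as $x_i \ne a_i$. *)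

(* Defs.v *)
From Stdlib Require Export Reals ZArith Znumtheory List Lia.
From Stdlib Require Export Zfloor.
From Coquelicot Require Export Coquelicot.
Export ListNotations.

Open Scope R_scope.

Definition zeta3 : R := Series (fun n : nat => / (INR (S n) ^ 3)).

Definition zeta3_partial (N : nat) : R :=
  sum_n_m (fun j : nat => / (INR j ^ 3)) 1 N.

Definition zeta3_tail (N : nat) : R := zeta3 - zeta3_partial N.

Fixpoint pell (n : nat) : nat :=
  match n with
  | O => 0
  | S m => match m with
           | O => 1
           | S l => 2 * pell m + pell l
           end
  end.

Definition pell_companion (n : nat) : nat :=
  match n with
  | O => 1
  | S m => pell n + pell m
  end.

Definition M (k : nat) : Z := Z.of_nat (pell (2 * k + 1)).

(* The truncated subtraction and the division are exact: see [Nidx_exact]. *)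
Definition Nidx (k : nat) : nat := (pell_companion (2 * k + 1) - 1) / 2.

Lemma Nidx_exact (k : nat) : (2 * Nidx k + 1 = pell_companion (2 * k + 1))%nat.
Proof.
assert (H : forall n, exists a, (pell (S n) + pell n = 2 * a + 1)%nat).
{ induction n as [|n [a Ha]].
  - now exists 0%nat.
  - exists (pell (S n) + a)%nat.
    change (pell (S (S n))) with (2 * pell (S n) + pell n)%nat. lia. }
destruct (H (2 * k)%nat) as [a Ha].
unfold Nidx.
replace (2 * k + 1)%nat with (S (2 * k)) by lia.
change (pell_companion (S (2 * k))) with (pell (S (2 * k)) + pell (2 * k))%nat.
rewrite Ha.
replace (2 * a + 1 - 1)%nat with (a * 2)%nat by lia.
rewrite Nat.div_mul by discriminate. lia.
Qed.

(* The complete quotient x_i of the continued fraction algorithm; [None] when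
   the algorithm has stopped before step i. *)
Fixpoint complete_quotient (x : R) (i : nat) : option R :=
  match i with
  | O => Some x
  | S j => match complete_quotient x j with
           | Some y => if Req_dec_T y (IZR (Zfloor y)) then None
                       else Some (/ (y - IZR (Zfloor y)))
           | None => None
           end
  end.

Definition partial_quotient (x : R) (i : nat) : option Z :=
  option_map Zfloor (complete_quotient x i).

Definition cf_begins (x : R) (l : list Z) : Prop :=
  map (partial_quotient x) (seq 0 (length l)) = map Some l.

(* [r k] is never 0: M k = P_(k+1)^2 + P_k^2 is a sum of two coprime squares,
   hence not divisible by 3. *)
Definition r (k : nat) : Z := ((10 * M k) mod 261)%Z.

Definition epsilon (k : nat) : Z :=
  if Zdivide_dec (r k) 261 then (-1)%Z else 0%Z.

(* Main.v *)
Require Import Defs.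
From Stdlib Require Import Lra.

(** Put m = M_k and q = 2 N_k + 1 = Q_{2k+1}, so that the Pell equation gives
    q^2 = 2 m^2 - 1. The midpoint form of the Euler-Maclaurin expansion of
    R_N = sum_{j > N} j^{-3} runs over even powers of N + 1/2 only, that is over
    powers of v = 1 / (2N+1)^2:
      R_N ~ 2 v - 2 v^2 + (14/3) v^3 - (62/3) v^4 + (762/5) v^5 - (5110/3) v^6 + ...
    At v = 1 / (2 m^2 - 1) it becomes an expansion in powers of 1/m, which after
    taking square roots and inverting reads
      1 / sqrt R = m - delta,
      1 / delta  = 6 m^3 + 12 m - eta,
      1 / eta    = (10 m + s) / 261   with s about 59 / m.
    The first five partial quotients after 0 and the sixth complete quotient
    261 / (10 m mod 261 + s) can be read off from this nested form, as soon as
    s is known to be positive and small.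

    The error s is enclosed in (0, 60/m) by elementary means. Two truncations of
    the expansion of R_N, with different coefficients of v^6, are strict lower and
    upper bounds for R_N, because their successive differences compare with
    j^{-3} ([zeta3_tail_gt], [zeta3_tail_lt]). Comparing these rational functions
    with the squares of the nested fractions for s = 60/m and s = 0 is a matter of
    polynomial inequalities in m^2, settled by [horner_pos]
    ([inverse_sqrt_zeta3_tail]).

    The last quotient is floor(261 / (r + s)). Since s > 0, it is less than 261/r,
    which costs one unit exactly when r divides 261; as s is small nothing else
    changes ([last_quotient]). Here r is not 0 because 3 does not divide m: modulo
    3 the equation q^2 + 1 = 2 m^2 would make -1 a square. For k >= 6 the number m
    is so large that every r is covered by one estimate; k = 3, 4, 5 are checked
    from the values of r. *)

(** * Continued fractions written as nested fractions *)

(** The algorithm applied to a + 1/z drops a and continues with z; this allows the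
    expansion to be read off a nested fraction from the outside in. *)
Lemma complete_quotient_tail (x z : R) (a : Z) (i : nat) :
  x = IZR a + / z -> 1 < z ->
  complete_quotient x (S i) = complete_quotient z i.
Proof.
intros Hx Hz.
assert (Hz' : 0 < / z < 1).
{ split; [apply Rinv_0_lt_compat; lra|].
  rewrite <- Rinv_1; apply Rinv_lt_contravar; lra. }
assert (Hf : Zfloor x = a) by (apply Zfloor_eq; lra).
induction i as [|i IH].
- cbn. rewrite Hf.
  destruct (Req_dec_T x (IZR a)) as [e|_]; [lra|].
  f_equal. rewrite Hx.
  replace (IZR a + / z - IZR a) with (/ z) by ring. apply Rinv_inv.
- change (complete_quotient x (S (S i))) with
    (match complete_quotient x (S i) with
     | Some y => if Req_dec_T y (IZR (Zfloor y)) then None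
                 else Some (/ (y - IZR (Zfloor y)))
     | None => None
     end).
  rewrite IH. reflexivity.
Qed.

Lemma cf_begins_cons (x z : R) (a : Z) (l : list Z) :
  x = IZR a + / z -> 1 < z -> cf_begins z l -> cf_begins x (a :: l).
Proof.
unfold cf_begins. intros Hx Hz Hl. cbn [length seq map]. f_equal.
- unfold partial_quotient. cbn. f_equal. apply Zfloor_eq.
  assert (0 < / z) by (apply Rinv_0_lt_compat; lra).
  assert (/ z < 1) by (rewrite <- Rinv_1; apply Rinv_lt_contravar; lra). lra.
- rewrite <- Hl, <- seq_shift, map_map. apply map_ext. intros i.
  unfold partial_quotient. now rewrite (complete_quotient_tail x z a i).
Qed.

Lemma cf_begins_floor (x : R) (a : Z) :
  IZR a <= x < IZR a + 1 -> cf_begins x [a].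
Proof.
intros H. unfold cf_begins, partial_quotient. cbn. now rewrite (Zfloor_eq a x H).
Qed.

(** * Positivity of polynomials to the right of a point *)

Definition horner (l : list Z) (x : R) : R :=
  fold_right (fun c y => IZR c + x * y) 0 l.

(** [None] when some partial result of Horner's scheme at [a] is negative. *)
Definition horner_nonneg (l : list Z) (a : Z) : option Z :=
  fold_right (fun c o => match o with
                         | Some b => if (0 <=? c + a * b)%Z then Some (c + a * b)%Z
                                     else None
                         | None => None
                         end) (Some 0%Z) l.

Lemma horner_lower_bound (l : list Z) (a b : Z) (x : R) :
  (0 <= a)%Z -> IZR a <= x -> horner_nonneg l a = Some b ->
  0 <= IZR b <= horner l x.
Proof.
intros Ha Hx. apply IZR_le in Ha. revert b.
induction l as [|c l IH]; intros b.
- intros [= <-]. cbn. lra.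
- cbn. fold (horner_nonneg l a). fold (horner l x).
  destruct (horner_nonneg l a) as [b'|]; [|discriminate].
  destruct (Z.leb_spec 0 (c + a * b')) as [H|H]; [|discriminate].
  intros [= <-]. specialize (IH b' eq_refl).
  apply IZR_le in H. rewrite plus_IZR, mult_IZR in *. nra.
Qed.

(** Laguerre's criterion: Horner's scheme is monotone in the point as long as its
    partial results are nonnegative, so one integer evaluation at [a] bounds the
    polynomial from below on all of [a, +oo). *)
Lemma horner_pos (l : list Z) (a : Z) (x : R) :
  (0 <= a)%Z -> IZR a <= x ->
  match horner_nonneg l a with Some b => (0 <? b)%Z | None => false end = true ->
  0 < horner l x.
Proof.
intros Ha Hx H. destruct (horner_nonneg l a) as [b|] eqn:E; [|discriminate].
destruct (horner_lower_bound l a b x Ha Hx E) as [_ Hb].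
apply Z.ltb_lt, IZR_lt in H. lra.
Qed.

(** * Enclosure of the tail of zeta(3) *)

Lemma zeta3_partial_S (n : nat) :
  zeta3_partial (S n) = zeta3_partial n + / (INR (S n) ^ 3).
Proof. unfold zeta3_partial. rewrite sum_n_Sm by lia. reflexivity. Qed.

Lemma zeta3_partial_sum_n (n : nat) :
  sum_n (fun j => / (INR (S j) ^ 3)) n = zeta3_partial (S n).
Proof.
unfold sum_n, zeta3_partial. now rewrite (sum_n_m_S (fun j => / (INR j ^ 3))).
Qed.

Lemma zeta3_partial_bound (n : nat) : zeta3_partial n <= 2 - 2 / INR (S n).
Proof.
induction n as [|n IH].
- unfold zeta3_partial. rewrite sum_n_m_zero by lia. cbn. unfold zero. cbn. lra.
- rewrite zeta3_partial_S.
  assert (Hn : 1 <= INR (S n)) by (rewrite S_INR; pose proof (pos_INR n); lra).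
  set (x := INR (S n)) in *.
  replace (INR (S (S n))) with (x + 1) by (unfold x; rewrite (S_INR (S n)); ring).
  enough (0 <= 2 / x - 2 / (x + 1) - / x ^ 3) by lra.
  replace (2 / x - 2 / (x + 1) - / x ^ 3)
    with ((2 * x + 1) * (x - 1) / (x ^ 3 * (x + 1))) by (field; lra).
  apply Rdiv_le_0_compat; [nra|].
  apply Rmult_lt_0_compat; [apply pow_lt|]; lra.
Qed.

Lemma is_lim_zeta3_partial : is_lim_seq zeta3_partial zeta3.
Proof.
assert (Hpos : forall n, 0 < / (INR (S n) ^ 3)).
{ intros n. apply Rinv_0_lt_compat, pow_lt, lt_0_INR. lia. }
destruct (ex_finite_lim_seq_incr zeta3_partial 2) as [l Hl].
- intros n. rewrite zeta3_partial_S. specialize (Hpos n). lra.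
- intros n. pose proof (zeta3_partial_bound n).
  assert (0 < 2 / INR (S n)).
  { apply Rdiv_lt_0_compat; [lra|]. apply lt_0_INR. lia. }
  lra.
- enough (zeta3 = l) as -> by exact Hl.
  apply is_series_unique.
  change (is_lim_seq (sum_n (fun j => / (INR (S j) ^ 3))) l).
  apply is_lim_seq_ext with (fun n => zeta3_partial (S n)).
  + intros n. symmetry. apply zeta3_partial_sum_n.
  + now apply is_lim_seq_incr_1 in Hl.
Qed.

Lemma lim_lt_of_decreasing (u : nat -> R) (l : R) (N : nat) :
  is_lim_seq u l -> (forall n, (N <= n)%nat -> u (S n) < u n) -> l < u N.
Proof.
intros Hl Hu. apply Rle_lt_trans with (u (S N)); [|now apply Hu].
assert (Hle : forall n, u (n + S N)%nat <= u (S N)).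
{ induction n as [|n IH]; cbn; [lra|].
  specialize (Hu (n + S N)%nat ltac:(lia)). lra. }
apply is_lim_seq_incr_n with (N := S N) in Hl.
exact (is_lim_seq_le _ _ _ _ Hle Hl (is_lim_seq_const (u (S N)))).
Qed.

Lemma zeta3_tail_lt_of_telescoping (h : nat -> R) (N : nat) :
  is_lim_seq h 0 ->
  (forall n, (N <= n)%nat -> / INR (S n) ^ 3 < h n - h (S n)) ->
  zeta3_tail N < h N.
Proof.
intros Hh Hn.
enough (zeta3 < zeta3_partial N + h N) by (unfold zeta3_tail; lra).
apply (lim_lt_of_decreasing (fun n => zeta3_partial n + h n)).
- replace (Finite zeta3) with (Finite (zeta3 + 0)) by (f_equal; ring).
  now apply is_lim_seq_plus'; [apply is_lim_zeta3_partial|].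
- intros n HN. rewrite zeta3_partial_S. specialize (Hn n HN). lra.
Qed.

Lemma zeta3_tail_gt_of_telescoping (h : nat -> R) (N : nat) :
  is_lim_seq h 0 ->
  (forall n, (N <= n)%nat -> h n - h (S n) < / INR (S n) ^ 3) ->
  h N < zeta3_tail N.
Proof.
intros Hh Hn.
enough (- zeta3 < - (zeta3_partial N + h N)) by (unfold zeta3_tail; lra).
apply (lim_lt_of_decreasing (fun n => - (zeta3_partial n + h n))).
- replace (Finite (- zeta3)) with (Rbar_opp (zeta3 + 0)) by (cbn; f_equal; ring).
  apply is_lim_seq_opp with (u := fun n => zeta3_partial n + h n).
  now apply is_lim_seq_plus'; [apply is_lim_zeta3_partial|].
- intros n HN. rewrite zeta3_partial_S. specialize (Hn n HN). lra.
Qed.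

(** Truncation after v^6 of the expansion of R_N at v = 1 / (2N+1)^2, with the
    last coefficient left free. The true value of [c] is 5110/3. *)
Definition tail_expansion (c v : R) : R :=
  2 * v - 2 * v ^ 2 + 14 / 3 * v ^ 3 - 62 / 3 * v ^ 4 + 762 / 5 * v ^ 5 - c * v ^ 6.

Lemma is_lim_tail_expansion (c : R) :
  is_lim_seq (fun n => tail_expansion c (/ (2 * INR n + 1) ^ 2)) 0.
Proof.
assert (Hu : is_lim_seq (fun n => / (2 * INR n + 1)) 0).
{ replace (Finite 0) with (Rbar_inv p_infty) by reflexivity.
  apply is_lim_seq_inv; [|discriminate].
  apply is_lim_seq_le_p_loc with INR; [|exact is_lim_seq_INR].
  exists 0%nat. intros n _. pose proof (pos_INR n). lra. }
replace (Finite 0) with (Finite (tail_expansion c (0 ^ 2)))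
  by (unfold tail_expansion; f_equal; ring).
apply is_lim_seq_ext with (fun n => tail_expansion c ((/ (2 * INR n + 1)) ^ 2)).
{ intros n. now rewrite pow_inv. }
apply (is_lim_seq_continuous (fun t => tail_expansion c (t ^ 2))); [|exact Hu].
unfold tail_expansion. reg.
Qed.

(** With the true coefficient of v^6 the first omitted term of the alternating
    expansion is positive, which is why this truncation stays below R_N. *)
Lemma zeta3_tail_gt (N : nat) :
  tail_expansion (5110 / 3) (/ (2 * INR N + 1) ^ 2) < zeta3_tail N.
Proof.
apply (zeta3_tail_gt_of_telescoping
         (fun n => tail_expansion (5110 / 3) (/ (2 * INR n + 1) ^ 2))).
{ apply is_lim_tail_expansion. }
intros n _. rewrite !S_INR.
assert (Hx : 1 <= INR n + 1) by (pose proof (pos_INR n); lra).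
set (x := INR n + 1) in *.
replace (2 * INR n + 1) with (2 * x - 1) by (unfold x; ring).
apply Rlt_0_minus.
(* Multiplied by 15 x^3 (4 x^2 - 1)^12 the difference becomes a polynomial in x^2,
   since it is an odd function of x. Its degree is only 6: the expansion misses
   x^{-3} by a term of order x^{-15}. *)
assert (Hp : 0 < horner [15; -720; 1159280; 86200320; 1291468032;
                         5328031744; 5793697792]%Z (x ^ 2)).
{ apply (horner_pos _ 1); [lia|nra|reflexivity]. }
match type of Hp with 0 < ?p =>
  replace (_ - _) with (p / (15 * x ^ 3 * (2 * x - 1) ^ 12 * (2 * x + 1) ^ 12)) end.
- apply Rdiv_lt_0_compat; [exact Hp|].
  repeat apply Rmult_lt_0_compat; try apply pow_lt; lra.
- unfold horner, tail_expansion. cbn [fold_right]. field. lra.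
Qed.

(** Lowering 5110/3 to 1500 in the negative term v^6 outweighs all omitted terms,
    once v is small. *)
Lemma zeta3_tail_lt (N : nat) :
  (5 <= N)%nat ->
  zeta3_tail N < tail_expansion 1500 (/ (2 * INR N + 1) ^ 2).
Proof.
intros HN.
apply (zeta3_tail_lt_of_telescoping
         (fun n => tail_expansion 1500 (/ (2 * INR n + 1) ^ 2))).
{ apply is_lim_tail_expansion. }
intros n Hn. rewrite !S_INR.
assert (Hx : 6 <= INR n + 1).
{ assert (H5 := le_INR 5 n ltac:(lia)). cbn in H5. lra. }
set (x := INR n + 1) in *.
replace (2 * INR n + 1) with (2 * x - 1) by (unfold x; ring).
apply Rlt_0_minus.
(* One degree more than for the lower bound, as the coefficient of v^6 no longer
   cancels the term of order x^{-13}. *)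
assert (Hp : 0 < horner [-15; 720; -1012880; -75464320; -1136869632;
                         -4709638144; -5106593792; 149913600]%Z (x ^ 2)).
{ apply (horner_pos _ 35); [lia|nra|reflexivity]. }
match type of Hp with 0 < ?p =>
  replace (_ - _) with (p / (15 * x ^ 3 * (2 * x - 1) ^ 12 * (2 * x + 1) ^ 12)) end.
- apply Rdiv_lt_0_compat; [exact Hp|].
  repeat apply Rmult_lt_0_compat; try apply pow_lt; lra.
- unfold horner, tail_expansion. cbn [fold_right]. field. lra.
Qed.

(** * The nested form of 1 / sqrt R *)

(** The 1 / delta of the introduction, as a function of m and of the error s. *)
Definition inverse_delta (m s : R) : R := 6 * m ^ 3 + 12 * m - 261 / (10 * m + s).

Definition nested (m s : R) : R := m - / inverse_delta m s.

(** The two sides agree up to order m^{-10}, and the term of order m^{-12} decides.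
    It has the right sign because 1500 is still close enough to 5110/3. *)
Lemma tail_expansion_lt_nested (m : R) :
  169 <= m -> tail_expansion 1500 (/ (2 * m ^ 2 - 1)) < / nested m 0 ^ 2.
Proof.
intros Hm.
assert (Hy : 28561 <= m ^ 2) by nra.
assert (Hb : 0 < 60 * (m ^ 2) ^ 2 + 120 * m ^ 2 - 271) by nra.
apply Rlt_0_minus.
assert (Hp : 0 < horner [1021815; 1839421286; -2065711192; 60514960;
                         315719920; 18511200]%Z (m ^ 2)).
{ apply (horner_pos _ 3); [lia|lra|reflexivity]. }
replace (nested m 0) with
  (m * (60 * (m ^ 2) ^ 2 + 120 * m ^ 2 - 271) / (60 * (m ^ 2) ^ 2 + 120 * m ^ 2 - 261)).
2:{ unfold nested, inverse_delta. field. repeat split; apply Rgt_not_eq; nra. }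
match type of Hp with 0 < ?p =>
  replace (_ - _) with
    (p / (15 * (2 * m ^ 2 - 1) ^ 6 * m ^ 2 * (60 * (m ^ 2) ^ 2 + 120 * m ^ 2 - 271) ^ 2))
end.
- apply Rdiv_lt_0_compat; [exact Hp|].
  repeat apply Rmult_lt_0_compat; try apply pow_lt; lra.
- unfold horner, tail_expansion. cbn [fold_right]. field.
  repeat split; apply Rgt_not_eq; lra.
Qed.

(** The error s is 15360 / (261 m) + O(m^{-3}), where 15360 / 261 is slightly below
    59; rounding up to 60 leaves room for the terms of higher order. *)
Lemma tail_expansion_gt_nested (m : R) :
  169 <= m ->
  / nested m (60 / m) ^ 2 < tail_expansion (5110 / 3) (/ (2 * m ^ 2 - 1)).
Proof.
intros Hm.
assert (Hy : 28561 <= m ^ 2) by nra.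
assert (Hc : 0 < 60 * (m ^ 2) ^ 2 + 480 * m ^ 2 + 459) by nra.
assert (Hq : 0 < 60 * (m ^ 2) ^ 3 + 480 * (m ^ 2) ^ 2 + 449 * m ^ 2 - 60).
{ assert (0 < (m ^ 2) ^ 3) by (apply pow_lt; lra). nra. }
apply Rlt_0_minus.
assert (Hp : 0 < horner [-101793600; 1544729865; -4419734656; -10894272968;
                         -5806057600; -623332720; 576000]%Z (m ^ 2)).
{ apply (horner_pos _ 1092); [lia|lra|reflexivity]. }
replace (nested m (60 / m)) with
  ((60 * (m ^ 2) ^ 3 + 480 * (m ^ 2) ^ 2 + 449 * m ^ 2 - 60)
   / (m * (60 * (m ^ 2) ^ 2 + 480 * m ^ 2 + 459))).
2:{ unfold nested, inverse_delta. field. repeat split; apply Rgt_not_eq; nra. }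
match type of Hp with 0 < ?p =>
  replace (_ - _) with
    (p / (15 * (2 * m ^ 2 - 1) ^ 6
          * (60 * (m ^ 2) ^ 3 + 480 * (m ^ 2) ^ 2 + 449 * m ^ 2 - 60) ^ 2))
end.
- apply Rdiv_lt_0_compat; [exact Hp|].
  repeat apply Rmult_lt_0_compat; try apply pow_lt; lra.
- unfold horner, tail_expansion. cbn [fold_right]. field.
  repeat split; apply Rgt_not_eq; lra.
Qed.

Lemma inverse_delta_gt_2 (m s : R) : 169 <= m -> 0 <= s -> 2 < inverse_delta m s.
Proof.
intros Hm Hs. unfold inverse_delta.
assert (H : 261 / (10 * m + s) < 1) by (apply Rlt_div_l; lra).
assert (0 < m ^ 3) by (apply pow_lt; lra). lra.
Qed.

Lemma nested_gt (m s : R) : 169 <= m -> 0 <= s -> m - 1 < nested m s.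
Proof.
intros Hm Hs. pose proof (inverse_delta_gt_2 m s Hm Hs).
assert (/ inverse_delta m s < 1).
{ rewrite <- Rinv_1. apply Rinv_lt_contravar; lra. }
unfold nested. lra.
Qed.

Lemma inverse_sqrt_between (x a b : R) :
  0 < a -> 0 < b -> / b ^ 2 < x < / a ^ 2 -> a < / sqrt x < b.
Proof.
intros Ha Hb [H1 H2].
assert (Hb2 : 0 < / b ^ 2) by (apply Rinv_0_lt_compat, pow_lt, Hb).
assert (Hx : 0 < sqrt x) by (apply sqrt_lt_R0; lra).
assert (E : forall c, 0 < c -> sqrt (/ c ^ 2) = / c).
{ intros c Hc. rewrite <- pow_inv. apply sqrt_pow2.
  left. now apply Rinv_0_lt_compat. }
split.
- rewrite <- (Rinv_inv a). apply Rinv_lt_contravar.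
  + apply Rmult_lt_0_compat; [exact Hx | now apply Rinv_0_lt_compat].
  + rewrite <- (E a Ha). apply sqrt_lt_1_alt. lra.
- rewrite <- (Rinv_inv b). apply Rinv_lt_contravar.
  + apply Rmult_lt_0_compat; [now apply Rinv_0_lt_compat | exact Hx].
  + rewrite <- (E b Hb). apply sqrt_lt_1_alt. lra.
Qed.

(** [nested m] is a composition of invertible monotone steps; undoing them one by
    one turns bounds for rho into bounds for s. *)
Lemma nested_onto (m rho s0 s1 : R) :
  169 <= m -> 0 <= s0 -> 0 <= s1 -> nested m s0 < rho < nested m s1 ->
  exists s, s0 < s < s1 /\ rho = nested m s.
Proof.
intros Hm H0 H1 [Hr0 Hr1].
pose proof (inverse_delta_gt_2 m s0 Hm H0) as G0.
pose proof (inverse_delta_gt_2 m s1 Hm H1) as G1.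
unfold nested in Hr0, Hr1.
assert (D1 : 0 < / inverse_delta m s1) by (apply Rinv_0_lt_compat; lra).
set (delta := m - rho).
assert (Hd0 : / delta > inverse_delta m s0).
{ rewrite <- (Rinv_inv (inverse_delta m s0)). apply Rinv_lt_contravar.
  - apply Rmult_lt_0_compat; unfold delta; lra.
  - unfold delta; lra. }
assert (Hd1 : / delta < inverse_delta m s1).
{ rewrite <- (Rinv_inv (inverse_delta m s1)). apply Rinv_lt_contravar.
  - apply Rmult_lt_0_compat; unfold delta; lra.
  - unfold delta; lra. }
unfold inverse_delta in Hd0, Hd1.
set (eta := 6 * m ^ 3 + 12 * m - / delta).
assert (E1 : 0 < 261 / (10 * m + s1)) by (apply Rdiv_lt_0_compat; lra).
assert (He1 : 261 / (10 * m + s1) < eta) by (unfold eta; lra).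
assert (He0 : eta < 261 / (10 * m + s0)) by (unfold eta; lra).
exists (261 / eta - 10 * m). split.
- assert (Heta : 0 < eta) by lra.
  apply Rlt_div_l in He1; [|lra]. apply Rlt_div_r in He0; [|lra].
  split.
  + assert (10 * m + s0 < 261 / eta) by (apply Rlt_div_r; lra). lra.
  + assert (261 / eta < 10 * m + s1) by (apply Rlt_div_l; lra). lra.
- unfold nested, inverse_delta.
  replace (10 * m + (261 / eta - 10 * m)) with (261 / eta) by ring.
  replace (261 / (261 / eta)) with eta by (field; lra).
  replace (6 * m ^ 3 + 12 * m - eta) with (/ delta) by (unfold eta; ring).
  rewrite Rinv_inv. unfold delta. ring.
Qed.

Lemma inverse_sqrt_zeta3_tail (m : R) (N : nat) :
  169 <= m -> (5 <= N)%nat -> (2 * INR N + 1) ^ 2 = 2 * m ^ 2 - 1 ->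
  exists s, 0 < s < 60 / m /\ / sqrt (zeta3_tail N) = nested m s.
Proof.
intros Hm HN HP.
assert (Hs : 0 < 60 / m) by (apply Rdiv_lt_0_compat; lra).
pose proof (nested_gt m 0 Hm ltac:(lra)).
pose proof (nested_gt m (60 / m) Hm ltac:(lra)).
apply nested_onto; try lra.
apply inverse_sqrt_between; try lra.
pose proof (zeta3_tail_gt N) as L. pose proof (zeta3_tail_lt N HN) as U.
rewrite HP in L, U.
pose proof (tail_expansion_lt_nested m Hm).
pose proof (tail_expansion_gt_nested m Hm). lra.
Qed.

(** * Arithmetic of the Pell numbers *)

Lemma pell_le (a b : nat) : (a <= b)%nat -> (pell a <= pell b)%nat.
Proof.
induction 1 as [|b _ IH]; [lia|]. destruct b as [|b]; [cbn in *; lia|].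
change (pell (S (S b))) with (2 * pell (S b) + pell b)%nat. lia.
Qed.

Lemma M_lower_bound (a k : nat) : (a <= k)%nat -> (M a <= M k)%Z.
Proof. intros H. unfold M. apply inj_le, pell_le. lia. Qed.

Lemma pell_quadratic_form (k : nat) :
  let p := Z.of_nat (pell (S (2 * k))) in
  let p' := Z.of_nat (pell (2 * k)) in
  (p * p - 2 * p * p' - p' * p' = 1)%Z.
Proof.
induction k as [|k IH]; [reflexivity|]. cbv zeta in *.
replace (2 * S k)%nat with (S (S (2 * k))) by lia.
change (pell (S (S (S (2 * k)))))
  with (2 * (2 * pell (S (2 * k)) + pell (2 * k)) + pell (S (2 * k)))%nat.
change (pell (S (S (2 * k)))) with (2 * pell (S (2 * k)) + pell (2 * k))%nat.
rewrite !Nat2Z.inj_add, !Nat2Z.inj_mul, !Nat2Z.inj_add, !Nat2Z.inj_mul.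
change (Z.of_nat 2) with 2%Z. nia.
Qed.

Lemma pell_equation (k : nat) :
  ((2 * Z.of_nat (Nidx k) + 1) ^ 2 = 2 * M k ^ 2 - 1)%Z.
Proof.
pose proof (Nidx_exact k) as E. pose proof (pell_quadratic_form k) as Q.
cbv zeta in Q. unfold M.
replace (2 * k + 1)%nat with (S (2 * k)) in * by lia.
change (pell_companion (S (2 * k))) with (pell (S (2 * k)) + pell (2 * k))%nat in E.
replace (2 * Z.of_nat (Nidx k) + 1)%Z
  with (Z.of_nat (pell (S (2 * k))) + Z.of_nat (pell (2 * k)))%Z by lia.
lia.
Qed.

(** If 3 divided M, the Pell equation modulo 3 would make -1 a square. *)
Lemma M_not_divisible_by_3 (k : nat) : (M k mod 3 <> 0)%Z.
Proof.
intros H. pose proof (pell_equation k) as E.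
set (q := (2 * Z.of_nat (Nidx k) + 1)%Z) in *.
apply Z.mod_divide in H; [|lia]. destruct H as [c Hc].
assert (Hq := Z.div_mod q 3 ltac:(lia)).
assert (Hq3 := Z.mod_pos_bound q 3 ltac:(lia)).
set (d := (q / 3)%Z) in *.
assert (q mod 3 = 0 \/ q mod 3 = 1 \/ q mod 3 = 2)%Z as [e|[e|e]] by lia;
  rewrite e in Hq; rewrite Hq, Hc in E.
- assert (3 * (3 * d * d - 6 * c * c) = -1)%Z by lia. lia.
- assert (3 * (3 * d * d + 2 * d - 6 * c * c) = -2)%Z by lia. lia.
- assert (3 * (3 * d * d + 4 * d - 6 * c * c) = -5)%Z by lia. lia.
Qed.

Lemma r_bounds (k : nat) : (1 <= r k <= 260)%Z.
Proof.
pose proof (Z.mod_pos_bound (10 * M k) 261 ltac:(lia)) as H.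
enough (r k <> 0)%Z by (unfold r in *; lia).
intros H0. apply (M_not_divisible_by_3 k).
apply Z.mod_divide; [lia|].
apply Z.mod_divide in H0; [|lia]. destruct H0 as [c Hc].
(* 10 M = 261 c = 3 (87 c) gives M = 3 (87 c - 3 M). *)
exists (87 * c - 3 * M k)%Z. lia.
Qed.

(** * The last quotient *)

Lemma last_quotient_spec (k : nat) :
  let f := (261 / r k + epsilon k)%Z in
  (0 <= f /\ f * r k <= 260 /\ 261 <= (f + 1) * r k)%Z.
Proof.
cbv zeta. pose proof (r_bounds k) as Hr.
assert (Hd := Z.div_mod 261 (r k) ltac:(lia)).
assert (Hm := Z.mod_pos_bound 261 (r k) ltac:(lia)).
assert (Hq : (1 <= 261 / r k)%Z) by (apply Z.div_le_lower_bound; lia).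
unfold epsilon. destruct (Zdivide_dec (r k) 261) as [D|D].
- apply Z.mod_divide in D; [|lia]. nia.
- assert (261 mod r k <> 0)%Z by (intros e; apply D, Z.mod_divide; lia). nia.
Qed.

(** The hypothesis on f s says that s is too small to push 261 / (r + s) below
    f. *)
Lemma last_quotient (k : nat) (s : R) :
  let f := (261 / r k + epsilon k)%Z in
  0 < s -> IZR f * s <= 1 ->
  IZR f <= 261 / (IZR (r k) + s) < IZR f + 1.
Proof.
intros f Hs Hfs.
destruct (last_quotient_spec k) as (H0 & H1 & H2). fold f in H0, H1, H2.
assert (Hr : 1 <= IZR (r k)) by (apply IZR_le; pose proof (r_bounds k); lia).
apply IZR_le in H0, H1, H2. rewrite mult_IZR in H1, H2. rewrite plus_IZR in H2.
split.
- apply Rle_div_r; nra.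
- apply Rlt_div_l; nra.
Qed.

Lemma last_quotient_times_error (k : nat) (s : R) :
  (3 <= k)%nat -> 0 < s < 60 / IZR (M k) ->
  IZR (261 / r k + epsilon k) * s <= 1.
Proof.
intros Hk [Hs0 Hs].
destruct (last_quotient_spec k) as (H0 & H1 & _).
set (f := (261 / r k + epsilon k)%Z) in *.
pose proof (r_bounds k) as Hr.
assert (Hf : forall B C : Z, (f <= B)%Z -> (C <= M k)%Z -> (0 < C)%Z ->
                        (60 * B <= C)%Z -> IZR f * s <= 1).
{ intros B C HB HC HC0 HBC.
  apply IZR_le in HB, HC, HBC, H0. apply IZR_lt in HC0. rewrite mult_IZR in HBC.
  apply Rlt_div_r in Hs; [|lra]. nra. }
destruct (le_lt_dec 6 k) as [K|K].
- now apply (Hf 260 33461)%Z; [nia | exact (M_lower_bound 6 k K) | |].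
- (* Here r is 124, 193 or 251, so f is at most 2. *)
  apply (Hf 2 169)%Z; [|exact (M_lower_bound 3 k Hk)|easy|easy].
  enough (88 <= r k)%Z by nia.
  assert (k = 3 \/ k = 4 \/ k = 5)%nat as [->|[->| ->]] by lia;
    vm_compute; discriminate.
Qed.

Theorem theorem1p1 (k : nat) (hk : (3 <= k)%nat) :
  cf_begins (sqrt (zeta3_tail (Nidx k)))
    [0%Z;
     (M k - 1)%Z;
     1%Z;
     (6 * M k ^ 3 + 12 * M k - 2)%Z;
     1%Z;
     ((10 * M k - 261) / 261)%Z;
     (261 / r k + epsilon k)%Z].
Proof.
pose proof (M_lower_bound 3 k hk) as HM. change (M 3) with 169%Z in HM.
assert (HN : (5 <= Nidx k)%nat) by (pose proof (pell_equation k); nia).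
set (m := IZR (M k)).
assert (Hm : 169 <= m) by (apply IZR_le, HM).
assert (HP : (2 * INR (Nidx k) + 1) ^ 2 = 2 * m ^ 2 - 1).
{ pose proof (f_equal IZR (pell_equation k)) as E.
  rewrite minus_IZR, mult_IZR, <- !pow_IZR with (n := 2%nat), plus_IZR, mult_IZR,
    <- INR_IZR_INZ in E. exact E. }
destruct (inverse_sqrt_zeta3_tail m (Nidx k) Hm HN HP) as (s & Hs & Hrho).
assert (Hs1 : s < 1).
{ apply Rlt_trans with (60 / m); [lra|]. apply Rlt_div_l; lra. }
pose proof (nested_gt m s Hm ltac:(lra)) as Hnest.
pose proof (inverse_delta_gt_2 m s Hm ltac:(lra)) as HD.
set (D := inverse_delta m s) in *.
set (E := (10 * m + s) / 261).
assert (HE : 2 < E) by (unfold E; lra).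
pose proof (r_bounds k) as Hr.
assert (Hr' : 1 <= IZR (r k) <= 260) by (split; apply IZR_le; lia).
apply cf_begins_cons with (z := nested m s); [|lra|].
{ rewrite <- Hrho, Rinv_inv. ring. }
apply cf_begins_cons with (z := D / (D - 1)).
{ rewrite minus_IZR. fold m. unfold nested. fold D. field. lra. }
{ apply Rlt_div_r; lra. }
apply cf_begins_cons with (z := D - 1); [field; lra|lra|].
apply cf_begins_cons with (z := E / (E - 1)).
{ rewrite minus_IZR, plus_IZR, !mult_IZR, <- pow_IZR with (n := 3%nat).
  fold m. unfold D, inverse_delta.
  replace (261 / (10 * m + s)) with (/ E) by (unfold E; field; lra).
  field. lra. }
{ apply Rlt_div_r; lra. }
apply cf_begins_cons with (z := E - 1); [field; lra|lra|].
apply cf_begins_cons with (z := 261 / (IZR (r k) + s)).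
{ assert (Hdiv : (10 * M k = 261 * ((10 * M k - 261) / 261 + 1) + r k)%Z).
  { replace (10 * M k - 261)%Z with (10 * M k + (-1) * 261)%Z by ring.
    rewrite Z.div_add by lia. unfold r.
    pose proof (Z.div_mod (10 * M k) 261 ltac:(lia)). lia. }
  apply (f_equal IZR) in Hdiv.
  rewrite plus_IZR, !mult_IZR, plus_IZR in Hdiv. fold m in Hdiv.
  rewrite Rinv_div. unfold E. lra. }
{ apply Rlt_div_r; lra. }
apply cf_begins_floor, last_quotient; [lra|].
now apply last_quotient_times_error.
Qed.
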